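(* Let $\mathcal{H}$ be a real Hilbert space, $K\subset\mathcal{H}$ a nonempty closed convex set, and $F:\mathcal{H}\to\mathcal{H}$ an operator such that: (C1) $\Omega_D\neq\emptyset$; (C2) $F$ is quasimonotone and $L$-Lipschitz continuous on $\mathcal{H}$ (with $L>0$); (C3) whenever a sequence $\{x_k\}\subset\mathcal{H}$ converges weakly to $x$, one has $\|F(x)\|\le\liminf_{k\to\infty}\|F(x_k)\|$; (C4) with $A:=\{u\in K:F(u)=0\}\setminus\Omega_D$, for every $p\in\Omega_D$ there exists $\delta_p>0$ such that $\|y_1-y_2\|\ge 2\delta_p$ for any two distinct points $y_1,y_2\in A_p:=\{p\}\cup A$. Let $\lambda\in(0,\frac1L)$ and let $x(t),y(t)$, $t\ge 0$, be the trajectories generated by $$\begin{cases} y(t)=P_K(x(t)-\lambda F(x(t))),\\ \dot x(t)+x(t)=y(t)+\lambda\,[F(x(t))-F(y(t))],\\ x(0)=x_0\in\mathcal{H}.\end{cases}$$ Suppose moreover that, for a given $\epsilon\ge 0$, (C5) $y(t)\in K$ for all $t$ and $$\liminf_{t\to\infty}\frac{|\langle F(y(t)),y(t)-u\rangle|}{\|y(t)-u\|^{2+\epsilon}}>0,\qquad\forall u\in K.$$ Then the trajectory $x(t)$ converges strongly, as $t\to\infty$, to a point in $\Omega$.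
   Context: $P_K$ is the metric projection onto $K$. $\Omega:=\{x^*\in K:\langle F(x^* ),y-x^*\rangle\ge 0\ \ \forall y\in K\}$ is the solution set of the variational inequality $VI(F,K)$, and $\Omega_D:=\{x^*\in K:\langle F(y),y-x^*\rangle\ge 0\ \ \forall y\in K\}$. $F$ is quasimonotone on a set $S$ if for all $\xi,\eta\in S$, $\langle F(\xi),\eta-\xi\rangle>0$ implies $\langle F(\eta),\eta-\xi\rangle\ge 0$; in (C2) this is meant with $S=\mathcal{H}$. $F$ is $L$-Lipschitz if $\|F(\xi)-F(\eta)\|\le L\|\xi-\eta\|$ for all $\xi,\eta\in\mathcal{H}$. The trajectory $x:[0,\infty)\to\mathcal{H}$ exists and is unique by the global Cauchy–Lipschitz theorem. *)

(* Defs.v *)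
From HB Require Import structures.
From mathcomp Require Import all_boot all_order all_algebra sesquilinear.
From mathcomp Require Import all_classical all_reals all_analysis.

Set Implicit Arguments.
Unset Strict Implicit.
Unset Printing Implicit Defensive.

Import Order.TTheory GRing.Theory Num.Theory.
Import numFieldTopology.Exports numFieldNormedType.Exports.

Local Open Scope classical_set_scope.
Local Open Scope ring_scope.

(* A real Hilbert space is a complete normed module [H] over [R] together with
   an inner product [dot] that induces the norm of [H]. *)
Definition induces_norm (R : realType) (H : normedModType R)
    (dot : {dot H for idfun}) : Prop :=
  forall v : H, dot v v = `|v| ^+ 2.

Definition VI_solutions (R : realType) (H : normedModType R)
    (dot : {dot H for idfun}) (F : H -> H) (K : set H) : set H :=
  [set p | K p /\ forall y, K y -> 0 <= dot (F p) (y - p)].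

Definition dual_VI_solutions (R : realType) (H : normedModType R)
    (dot : {dot H for idfun}) (F : H -> H) (K : set H) : set H :=
  [set p | K p /\ forall y, K y -> 0 <= dot (F y) (y - p)].

Definition quasimonotone_on (R : realType) (H : normedModType R)
    (dot : {dot H for idfun}) (S : set H) (F : H -> H) : Prop :=
  forall xi eta, S xi -> S eta ->
    0 < dot (F xi) (eta - xi) -> 0 <= dot (F eta) (eta - xi).

Definition weakly_cvg (R : realType) (H : normedModType R)
    (dot : {dot H for idfun}) (u : nat -> H) (l : H) : Prop :=
  forall v : H, dot (u k) v @[k --> \oo] --> dot l v.

(* When [K] is a nonempty closed convex subset of a Hilbert space, the nearest
   point exists and is unique, so the default value [0] is never used. *)
Definition metric_proj (R : realType) (H : normedModType R)
    (K : set H) (z : H) : H :=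
  xget 0 [set p | K p /\ forall q, K q -> `|z - p| <= `|z - q|].

(* Derivative at [t] of a curve defined on [0, +oo[: two-sided for [0 < t],
   one-sided at [t = 0]; values of [x] at negative times are irrelevant. *)
Definition has_derivative_halfline (R : realType) (H : normedModType R)
    (x : R -> H) (t : R) (v : H) : Prop :=
  h^-1 *: (x (t + h) - x t) @[h --> within [set h | 0 <= t + h] 0^'] --> v.

Definition is_trajectory (R : realType) (H : normedModType R)
    (K : set H) (F : H -> H) (lambda : R) (x0 : H) (x y : R -> H) : Prop :=
  [/\ forall t, 0 <= t -> y t = metric_proj K (x t - lambda *: F (x t)),
      forall t, 0 <= t -> exists2 x't : H, has_derivative_halfline x t x't &
        x't + x t = y t + lambda *: (F (x t) - F (y t))
    & x 0 = x0].

(* Lower limit, as [t] tends to [+oo], of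
   [|<F (y t), y t - u>| / |y t - u| ^ (2 + eps)], over the times [t] at which
   this quotient is defined, i.e. [y t != u]; it is [+oo] if [y t = u] for all
   large [t]. *)
Definition liminf_quotient (R : realType) (H : normedModType R)
    (dot : {dot H for idfun}) (F : H -> H) (y : R -> H) (eps : R) (u : H) :
    \bar R :=
  limf_einf
    (fun t => (`|dot (F (y t)) (y t - u)| / `|y t - u| `^ (2 + eps))%:E)
    (within [set t | y t != u] (pinfty_nbhs R)).

(* Main.v *)
Require Import Defs.
From HB Require Import structures.
From mathcomp Require Import all_boot all_order all_algebra sesquilinear.
From mathcomp Require Import all_classical all_reals all_analysis.
From mathcomp Require Import ring lra.

Set Implicit Arguments.
Unset Strict Implicit.
Unset Printing Implicit Defensive.

Import Order.TTheory GRing.Theory Num.Theory.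
Import numFieldTopology.Exports numFieldNormedType.Exports.

Local Open Scope classical_set_scope.
Local Open Scope ring_scope.

(** Fix [p] in the dual solution set. Along the trajectory,

      d/dt (|x - p|^2 / 2) <= - (1 - lambda L) |x - y|^2
                              - lambda <F y, y - p>,

    because [y] is a projection onto [K], [p] lies in [K], and [F] is
    [L]-Lipschitz ([energy_decay]). Both terms on the right are nonpositive: the
    first since [lambda L < 1], the second since [p] is a dual solution. So
    [|x - p|] decreases.

    The quotient condition, taken at [u := p], makes the second term coercive:
    eventually [<F y, y - p> >= c |y - p|^(2 + eps)] for some [c > 0]
    ([liminf_quotient_gt0]). As long as [|x - p| >= 2 s], one of [|x - y|] and
    [|y - p|] is at least [s], hence [|x - p|^2] decreases at a rate bounded
    away from zero. A nonnegative function cannot do so forever, whence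
    [|x - p|^2 --> 0] ([strict_lyapunov_cvg0]): the trajectory converges
    strongly to [p] itself. Finally [p] solves the primal inequality, by the
    easy half of Minty's lemma ([dual_VI_sub_VI]).

    The projection inequality rests on the existence of nearest points in closed
    convex sets ([nearest_point_exists]). *)

(** * Inner products *)

Lemma dotC (R : realType) (H : lmodType R) (dot : {dot H for idfun}) (u v : H) :
  dot u v = dot v u.
Proof. by rewrite hermC expr0 mul1r. Qed.

Lemma sqr_normD (R : realType) (H : normedModType R)
    (dot : {dot H for idfun}) (dot_norm : induces_norm dot) (u v : H) :
  `|u + v| ^+ 2 = `|u| ^+ 2 + 2 * dot u v + `|v| ^+ 2.
Proof.
rewrite -!dot_norm linearDl !linearDr /= (dotC dot v u); ring.
Qed.

Lemma sqr_normB (R : realType) (H : normedModType R)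
    (dot : {dot H for idfun}) (dot_norm : induces_norm dot) (u v : H) :
  `|u - v| ^+ 2 = `|u| ^+ 2 - 2 * dot u v + `|v| ^+ 2.
Proof. by rewrite (sqr_normD dot_norm) linearNr normrN; ring. Qed.

(** Squaring the triangle inequality leaves exactly this bound on the cross
    term. *)
Lemma dot_le_norm (R : realType) (H : normedModType R)
    (dot : {dot H for idfun}) (dot_norm : induces_norm dot) (u v : H) :
  dot u v <= `|u| * `|v|.
Proof.
have : `|u + v| ^+ 2 <= (`|u| + `|v|) ^+ 2.
  by rewrite ler_sqr ?nnegrE ?addr_ge0// ler_normD.
by rewrite (sqr_normD dot_norm) sqrrD; lra.
Qed.

Lemma norm_dot_le (R : realType) (H : normedModType R)
    (dot : {dot H for idfun}) (dot_norm : induces_norm dot) (u v : H) :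
  `|dot u v| <= `|u| * `|v|.
Proof.
rewrite ler_norml dot_le_norm// andbT lerNl -linearNl -[`|u|]normrN.
exact: dot_le_norm.
Qed.

(** * Projection onto a closed convex set *)

Lemma convex_set_segment (R : realType) (H : normedModType R) (K : set H)
    (K_convex : convex_set K) (p q : H) (s : R) :
  K p -> K q -> 0 <= s -> s <= 1 -> K (p + s *: (q - p)).
Proof.
move=> Kp Kq s0 s1.
have /set_mem := K_convex q p (Itv01 s0 s1) (mem_set Kq) (mem_set Kp).
rewrite /conv/= /unstable.onem.
by rewrite scalerBl scale1r scalerBr addrCA.
Qed.

(** How a first-order condition is read off from an inequality that holds for
    all small positive steps [s], the term [s * b] being the error. *)
Lemma ge0_of_small_steps (R : realType) (a b : R) :
  (forall s, 0 < s -> s <= 1 -> 0 <= a + s * b) -> 0 <= a.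
Proof.
move=> ab; rewrite leNgt; apply/negP => a0.
have b0 : 0 < b by have := ab 1 ltr01 (lexx _); lra.
(* At this step [a + s * b] equals [- a ^+ 2 / (b - a)], which is negative. *)
have s0 : 0 < - a / (- a + b) by rewrite divr_gt0//; lra.
have s1 : - a / (- a + b) <= 1 by rewrite ler_pdivrMr; lra.
have := ab _ s0 s1.
have -> : a + - a / (- a + b) * b = - (a ^+ 2 / (- a + b)).
  by field; lra.
rewrite oppr_ge0 leNgt divr_gt0// ?exprn_even_gt0/=; lra.
Qed.

(** The parallelogram law makes a minimizing sequence for the distance Cauchy:
    midpoints stay in [K], so they are no closer to [z] than the infimum. *)
Lemma nearest_point_exists (R : realType) (H : completeNormedModType R)
    (dot : {dot H for idfun}) (dot_norm : induces_norm dot)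
    (K : set H) (K_nonempty : K !=set0) (K_closed : closed K)
    (K_convex : convex_set K) (z : H) :
  exists p, K p /\ forall q, K q -> `|z - p| <= `|z - q|.
Proof.
pose E := [set `|z - q| ^+ 2 | q in K].
have E_lb : lbound E 0 by move=> _ [q _ <-]; rewrite sqr_ge0.
have E_inf : has_inf E.
  split; last by exists 0.
  by have [q Kq] := K_nonempty; exists (`|z - q| ^+ 2), q.
have inf_le q : K q -> inf E <= `|z - q| ^+ 2.
  by move=> Kq; apply: (ge_inf E_inf.2); exists q.
have /choice[u u_min] (n : nat) :
    exists q, K q /\ `|z - q| ^+ 2 < inf E + harmonic n.
  by have [_ [q Kq <-] qlt] := inf_adherent (harmonic_gt0 n) E_inf; exists q.
have parallelogram q r : K q -> K r ->
    `|q - r| ^+ 2 <= 2 * `|z - q| ^+ 2 + 2 * `|z - r| ^+ 2 - 4 * inf E.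
  move=> Kq Kr.
  have half_ge0 : 0 <= 2^-1 :> R by lra.
  have half_le1 : 2^-1 <= 1 :> R by lra.
  have /inf_le mid := convex_set_segment K_convex Kq Kr half_ge0 half_le1.
  have {mid} : 4 * inf E <= `|(z - q) + (z - r)| ^+ 2.
    have -> : (z - q) + (z - r) = 2 *: (z - (q + 2^-1 *: (r - q))).
      rewrite scalerBr scalerDr scalerA divff ?pnatr_eq0// scale1r !scaler_nat.
      by rewrite !mulr2n -(addrA q q) (addrC r) addNKr opprD addrACA.
    by rewrite normrZ exprMn ger0_norm ?ler0n//; lra.
  have -> : q - r = (z - r) - (z - q) by rewrite opprB [RHS]addrC addrA subrK.
  rewrite (sqr_normB dot_norm) (sqr_normD dot_norm).
  by rewrite (dotC dot (z - q)); lra.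
have u_cauchy : cauchy (u @ \oo).
  apply/cauchyP => e e0.
  have e2 : 0 < e ^+ 2 / 4 by rewrite divr_gt0// exprn_gt0.
  have /cvgrPdist_lt/(_ _ e2) := @cvg_harmonic R.
  case=> N _ hN; exists (u N); exists N => // n /= Nn.
  rewrite -ball_normE /= -(ltr_pXn2r (n := 2))// ?nnegrE ?(ltW e0)//.
  have [KN uN] := u_min N; have [Kn un] := u_min n.
  have := hN N (leqnn N); have := hN n Nn.
  rewrite !sub0r !normrN !ger0_norm ?harmonic_ge0//.
  by have := parallelogram _ _ KN Kn; lra.
have u_cvg : cvg (u @ \oo) by exact: cauchy_cvg.
pose p := lim (u @ \oo).
have up : u @ \oo --> p by exact: u_cvg.
exists p; split.
  apply: (closed_cvg _ K_closed _ _ up).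
  by apply: nearW => n; have [] := u_min n.
move=> q Kq; rewrite -(ler_pXn2r (n := 2))// ?nnegrE//.
apply: le_trans (inf_le q Kq).
have zu : `|z - u n| ^+ 2 @[n --> \oo] --> `|z - p| ^+ 2.
  rewrite expr2; under eq_fun do rewrite expr2.
  by apply: cvgM; apply: cvg_norm; apply: cvgB => //; exact: cvg_cst.
have iE : inf E + harmonic n @[n --> \oo] --> inf E.
  rewrite -[X in _ --> X]addr0.
  by apply: cvgD; [exact: cvg_cst|exact: cvg_harmonic].
by apply: ler_cvg_to zu iE _; apply: nearW => n; have [_ /ltW] := u_min n.
Qed.

(** Moving from the projection towards any [q] in [K] cannot decrease the
    distance to [z]; the first-order term of that inequality is the obtuse-angle
    condition. *)
Lemma metric_projP (R : realType) (H : completeNormedModType R)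
    (dot : {dot H for idfun}) (dot_norm : induces_norm dot)
    (K : set H) (K_nonempty : K !=set0) (K_closed : closed K)
    (K_convex : convex_set K) (z : H) :
  let p := metric_proj K z in
  K p /\ forall q, K q -> dot (z - p) (q - p) <= 0.
Proof.
move=> p.
have [Kp p_min] : K p /\ forall q, K q -> `|z - p| <= `|z - q|.
  exact: (xgetPex 0 (nearest_point_exists dot_norm K_nonempty K_closed
    K_convex z)).
split=> // q Kq; rewrite -oppr_ge0 -(pmulr_rge0 _ (ltr0n R 2)).
apply: (@ge0_of_small_steps _ _ (`|q - p| ^+ 2)) => s s0 s1.
have Ks := convex_set_segment K_convex Kp Kq (ltW s0) s1.
have := p_min _ Ks; rewrite -(ler_pXn2r (n := 2))// ?nnegrE//.
rewrite opprD addrA (sqr_normB dot_norm (z - p)) linearZr_LR /= normrZ.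
rewrite exprMn (gtr0_norm s0); set a := dot _ _; set b := `|q - p| => h.
by rewrite -(pmulr_rge0 _ s0); lra.
Qed.

(** * Variational inequalities *)

(** Evaluating the dual inequality at [p + s (y - p)] and letting [s] tend to
    [0] gives the primal one, by continuity of [F]. *)
Lemma dual_VI_sub_VI (R : realType) (H : normedModType R)
    (dot : {dot H for idfun}) (dot_norm : induces_norm dot)
    (K : set H) (K_convex : convex_set K) (F : H -> H) (L : R)
    (F_lipschitz : L.-lipschitz F) :
  dual_VI_solutions dot F K `<=` VI_solutions dot F K.
Proof.
move=> p [Kp p_dual]; split=> // y Ky.
apply: (@ge0_of_small_steps _ _ (L * `|y - p| ^+ 2)) => s s0 s1.
have Ks := convex_set_segment K_convex Kp Ky (ltW s0) s1.
have := p_dual _ Ks; set r := p + _.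
have rp : r - p = s *: (y - p) by rewrite /r addrC addKr.
rewrite rp linearZr_LR /= pmulr_rge0// => Fr_ge0.
have /= := F_lipschitz (r, p) (conj I I).
rewrite rp normrZ (gtr0_norm s0) => Frp.
have := dot_le_norm dot_norm (F r - F p) (y - p).
rewrite linearBl /= => FrFp.
have : `|F r - F p| * `|y - p| <= L * (s * `|y - p|) * `|y - p|.
  exact: ler_wpM2r.
by rewrite expr2; lra.
Qed.

(** The projection inequality tested at [p] turns the cross term into
    [- lambda <F y, y - p>]; Lipschitz continuity absorbs the correction
    [lambda (F x - F y)] into the damping of [x - y]. *)
Lemma energy_decay (R : realType) (H : completeNormedModType R)
    (dot : {dot H for idfun}) (dot_norm : induces_norm dot)
    (K : set H) (K_nonempty : K !=set0) (K_closed : closed K)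
    (K_convex : convex_set K) (F : H -> H) (L lambda : R)
    (F_lipschitz : L.-lipschitz F) (lambda_ge0 : 0 <= lambda) (p x y : H) :
  K p -> y = metric_proj K (x - lambda *: F x) ->
  dot (x - p) (y + lambda *: (F x - F y) - x) <=
    - (1 - lambda * L) * `|x - y| ^+ 2 - lambda * dot (F y) (y - p).
Proof.
move=> Kp y_proj.
have [_ /(_ _ Kp)] := metric_projP dot_norm K_nonempty K_closed
  K_convex (x - lambda *: F x).
rewrite -y_proj => proj_le.
have /= := F_lipschitz (x, y) (conj I I) => Fxy.
have := dot_le_norm dot_norm (x - y) (F x - F y) => CS.
have : lambda * (`|x - y| * `|F x - F y|) <=
    lambda * (`|x - y| * (L * `|x - y|)).
  by rewrite ler_wpM2l// ler_wpM2l.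
have : lambda * dot (x - y) (F x - F y) <= lambda * (`|x - y| * `|F x - F y|).
  by rewrite ler_wpM2l.
have : dot (x - p) (y + lambda *: (F x - F y) - x) =
   - `|x - y| ^+ 2 + lambda * dot (x - y) (F x - F y)
   + dot (x - lambda *: F x - y) (p - y) - lambda * dot (F y) (y - p).
  rewrite -dot_norm !(linearBl, linearDl, linearBr, linearDr, linearZr_LR,
    linearZl_LR, linearNl, linearNr) /=.
  rewrite (dotC dot y x) (dotC dot p x) (dotC dot p y).
  rewrite (dotC dot (F y) y) (dotC dot (F y) p).
  rewrite (dotC dot (F x) y) (dotC dot (F x) p).
  ring.
by rewrite expr2; lra.
Qed.

(** * Differential inequalities *)

(** The increment of [|x - p|^2] over a step [h] is
    [2 h <D, x t - p> + h^2 |D|^2], where [D] is the difference quotient of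
    [x]. *)
Lemma is_derive_sqr_dist (R : realType) (H : normedModType R)
    (dot : {dot H for idfun}) (dot_norm : induces_norm dot)
    (x : R -> H) (t : R) (v p : H) :
  0 < t -> has_derivative_halfline x t v ->
  is_derive t 1 (fun s => `|x s - p| ^+ 2) (2 * dot v (x t - p)).
Proof.
move=> t0 xv.
pose D h := h^-1 *: (x (t + h) - x t).
have Dv : D h @[h --> 0^'] --> v.
  apply: cvg_trans xv; apply: cvg_app => A nA.
  have {}nA : \forall h \near 0^', 0 <= t + h -> A h by exact: nA.
  have pos : \forall h \near 0^', 0 <= t + h.
    near=> h; have : `|h| < t by near: h; exact: dnbhs0_lt.
    by rewrite ltr_norml => /andP[th _]; lra.
  suff : \forall h \near 0^', A h by [].
  by near=> h; apply: (near nA h) => //; near: h.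
have dot_cvg : dot (D h) (x t - p) @[h --> 0^'] --> dot v (x t - p).
  apply/cvgrPdist_lt => e e0.
  have e1 : 0 < e / (`|x t - p| + 1) by rewrite divr_gt0// ltr_wpDl.
  move/cvgrPdist_lt : Dv => /(_ _ e1); apply: filterS => h.
  rewrite ltr_pdivlMr ?ltr_wpDl// -linearBl/=; apply: le_lt_trans.
  by rewrite (le_trans (norm_dot_le dot_norm _ _))// ler_wpM2l// lerDl.
have incr_cvg : 2 * dot (D h) (x t - p) + h * `|D h| ^+ 2 @[h --> 0^'] -->
    2 * dot v (x t - p) + 0 * `|v| ^+ 2.
  apply: cvgD; first exact: cvgZr.
  apply: cvgM; first exact: cvg_within.
  rewrite expr2; under eq_fun do rewrite expr2.
  by apply: cvgM; exact: cvg_norm.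
have quot_cvg : h^-1 *: (`|x (h *: 1 + t) - p| ^+ 2 - `|x t - p| ^+ 2)
    @[h --> 0^'] --> 2 * dot v (x t - p).
  move: incr_cvg; rewrite mul0r addr0; apply: cvg_trans.
  apply: near_eq_cvg; near=> h.
  have h0 : h != 0 by near: h; exact: nbhs_dnbhs_neq.
  have -> : x (h *: 1 + t) - p = h *: D h + (x t - p).
    rewrite /D scalerA divff// scale1r [h *: 1]mulr1 (addrC h).
    by rewrite addrA subrK.
  move: (D h) => d.
  rewrite (sqr_normD dot_norm (h *: d)) linearZl_LR /= normrZ exprMn.
  rewrite real_normK ?num_real//.
  move: (dot d _) `|d| `|x t - p| => a b c.
  by rewrite /GRing.scale/=; field.
by apply: DeriveDef; [apply/cvg_ex; eexists; exact: quot_cvg|exact: cvg_lim].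
Unshelve. all: by end_near. Qed.

(** If [V] never fell below [r], it would decrease at a fixed positive rate
    forever and become negative; hence it gets below every [r > 0], and stays
    there by monotonicity. *)
Lemma strict_lyapunov_cvg0 (R : realType) (V dV : R -> R) (T : R) :
  (forall t, 0 <= V t) ->
  (forall t, T <= t -> is_derive t 1 V (dV t)) ->
  (forall t, T <= t -> dV t <= 0) ->
  (forall r, 0 < r -> exists2 m, 0 < m &
     forall t, T <= t -> r <= V t -> dV t <= - m) ->
  V t @[t --> +oo] --> 0.
Proof.
move=> V_ge0 V_der dV_le0 dV_lt0.
have MVT_V a b : T <= a -> a <= b ->
    exists2 c, T <= c & V b - V a = dV c * (b - a).
  move=> Ta ab.
  have V_der_ab c : c \in `]a, b[ -> is_derive c 1 V (dV c).
    by rewrite in_itv/= => /andP[ac _]; apply: V_der; lra.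
  have V_cont : {within `[a, b], continuous V}.
    apply: derivable_within_continuous => c; rewrite in_itv/= => /andP[ac _].
    have Tc : T <= c by lra.
    by have := V_der _ Tc; case.
  have [c] := MVT_segment ab V_der_ab V_cont.
  by rewrite in_itv/= => /andP[ac _] ->; exists c => //; lra.
have V_nincr a b : T <= a -> a <= b -> V b <= V a.
  move=> Ta ab; have [c Tc Vab] := MVT_V _ _ Ta ab.
  by rewrite -subr_le0 Vab mulr_le0_ge0 ?dV_le0// subr_ge0.
apply/cvgrPdist_lt => r r0.
have [a Ta Va] : exists2 a, T <= a & V a < r.
  apply: contrapT => V_large.
  have {}V_large t : T <= t -> r <= V t.
    by move=> Tt; rewrite leNgt; apply/negP => Vt; apply: V_large; exists t.
  have [m m0 dVm] := dV_lt0 _ r0.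
  have Vm : 0 <= V T / m by rewrite divr_ge0// ltW.
  have Tb : T <= T + V T / m by lra.
  have [c Tc] := MVT_V _ _ (lexx T) Tb.
  have : dV c * (V T / m) <= - m * (V T / m).
    by rewrite ler_wpM2r// dVm// V_large.
  have -> : - m * (V T / m) = - V T by field; rewrite gt_eqF.
  by rewrite addrAC subrr add0r; have := V_large _ Tb; lra.
exists a; split=> [|b ab]; first exact: num_real.
rewrite sub0r normrN ger0_norm//; apply: le_lt_trans Va.
by apply: V_nincr => //; exact: ltW.
Qed.

(** * Convergence of the trajectory *)

(** On times with [y t != u] the quotient is eventually bounded below by some
    [c > 0]; the value [+oo] of the lower limit arises when such times stop
    occurring, and then any [c] works. *)
Lemma liminf_quotient_gt0 (R : realType) (H : normedModType R)
    (dot : {dot H for idfun}) (F : H -> H) (y : R -> H) (eps : R) (u : H) :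
  (0 < liminf_quotient dot F y eps u)%E ->
  exists2 c, 0 < c & \forall t \near +oo,
    y t != u -> c * `|y t - u| `^ (2 + eps) <= `|dot (F (y t)) (y t - u)|.
Proof.
rewrite /liminf_quotient limf_einfE => /ereal_sup_gt[_ [A nA <-]].
move=> inf_gt0.
have [c c0 c_le] : exists2 c : R, 0 < c & forall t, A t ->
    c <= `|dot (F (y t)) (y t - u)| / `|y t - u| `^ (2 + eps).
  set I := ereal_inf _ in inf_gt0.
  have I_le t : A t ->
      (I <= (`|dot (F (y t)) (y t - u)| / `|y t - u| `^ (2 + eps))%:E)%E.
    by move=> At; apply: ereal_inf_lbound; exists t.
  move: I inf_gt0 I_le => [c| |] //= I0 I_le.
    by exists c => // t /I_le; rewrite lee_fin.
  by exists 1 => // t /I_le; rewrite leye_eq.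
have {}nA : \forall t \near +oo, y t != u -> A t by exact: nA.
exists c => //; move: nA; apply: filterS => t At yu.
have pow_gt0 : 0 < `|y t - u| `^ (2 + eps).
  by rewrite powR_gt0// normr_gt0 subr_eq0.
by have := c_le _ (At yu); rewrite (ler_pdivlMr _ _ pow_gt0).
Qed.

Theorem proposition3p8 (R : realType) (H : completeNormedModType R)
    (dot : {dot H for idfun}) (dot_norm : induces_norm dot)
    (K : set H) (K_nonempty : K !=set0) (K_closed : closed K)
    (K_convex : convex_set K)
    (F : H -> H) (L : R) (L_gt0 : 0 < L)
    (C1 : dual_VI_solutions dot F K !=set0)
    (C2_quasimonotone : quasimonotone_on dot setT F)
    (C2_lipschitz : L.-lipschitz F)
    (C3 : forall (u : nat -> H) (l : H), weakly_cvg dot u l ->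
      (`|F l|%:E <= limn_einf (fun k => `|F (u k)|%:E))%E)
    (C4 : let A := [set u | K u /\ F u = 0] `\` dual_VI_solutions dot F K in
      forall p, dual_VI_solutions dot F K p ->
      exists2 delta : R, 0 < delta &
        forall y1 y2, (p |` A) y1 -> (p |` A) y2 -> y1 <> y2 ->
          2 * delta <= `|y1 - y2|)
    (lambda : R) (lambda_gt0 : 0 < lambda) (lambda_lt : lambda < 1 / L)
    (x0 : H) (x y : R -> H)
    (xy_trajectory : is_trajectory K F lambda x0 x y)
    (eps : R) (eps_ge0 : 0 <= eps)
    (C5_mem : forall t, 0 <= t -> K (y t))
    (C5_liminf : forall u, K u -> (0 < liminf_quotient dot F y eps u)%E) :
  exists2 q, VI_solutions dot F K q & x t @[t --> +oo] --> q.
Proof.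
have [p p_dual] := C1; have [Kp p_dualP] := p_dual.
exists p; first exact: (dual_VI_sub_VI dot_norm K_convex C2_lipschitz).
have [y_proj x_der _] := xy_trajectory.
have [c c0 [M [_ c_le]]] := liminf_quotient_gt0 (C5_liminf p Kp).
pose T := Num.max M 0 + 1.
have T_gt t : T <= t -> 0 < t /\ M < t.
  have M_le : M <= Num.max M 0 by rewrite le_max lexx.
  have max_ge0 : 0 <= Num.max M 0 by rewrite le_max lexx orbT.
  by rewrite /T => Tt; split; lra.
pose kappa := 1 - lambda * L.
have kappa0 : 0 < kappa by rewrite /kappa subr_gt0 -ltr_pdivlMr.
pose x' t := y t + lambda *: (F (x t) - F (y t)) - x t.
have V_der t : T <= t ->
    is_derive t 1 (fun s => `|x s - p| ^+ 2) (2 * dot (x' t) (x t - p)).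
  move=> /T_gt[t0 _]; apply: is_derive_sqr_dist => //.
  have [v xv vE] := x_der t (ltW t0).
  by rewrite /x' -vE addrK.
have decay t : T <= t -> 2 * dot (x' t) (x t - p) <=
    - (2 * (kappa * `|x t - y t| ^+ 2 + lambda * dot (F (y t)) (y t - p))).
  move=> /T_gt[t0 _].
  have := energy_decay dot_norm K_nonempty K_closed K_convex
    C2_lipschitz (ltW lambda_gt0) Kp (y_proj t (ltW t0)).
  by rewrite dotC -/(x' t) -/kappa; lra.
have damping_ge0 t : 0 <= kappa * `|x t - y t| ^+ 2.
  by rewrite mulr_ge0 ?sqr_ge0// ltW.
have work_ge0 t : T <= t -> 0 <= lambda * dot (F (y t)) (y t - p).
  move=> /T_gt[t0 _].
  by rewrite mulr_ge0 ?(ltW lambda_gt0)// p_dualP//; exact/C5_mem/ltW.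
have sqr_dist_cvg0 : `|x t - p| ^+ 2 @[t --> +oo] --> 0.
  apply: (strict_lyapunov_cvg0 _ V_der) => [t|t Tt|r r0].
  - exact: sqr_ge0.
  - by have := decay _ Tt; have := damping_ge0 t; have := work_ge0 _ Tt; lra.
  pose s := Num.sqrt r / 2.
  have s0 : 0 < s by rewrite divr_gt0// sqrtr_gt0.
  pose m1 := kappa * s ^+ 2; pose m2 := lambda * (c * s `^ (2 + eps)).
  have m1_gt0 : 0 < m1 by rewrite mulr_gt0// exprn_gt0.
  have m2_gt0 : 0 < m2 by rewrite !mulr_gt0// powR_gt0.
  exists (2 * Num.min m1 m2); first by rewrite mulr_gt0// lt_min m1_gt0.
  move=> t Tt rV; have [t0 Mt] := T_gt _ Tt.
  apply: le_trans (decay _ Tt) _; rewrite lerN2 ler_wpM2l// ge_min.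
  have xp : 2 * s <= `|x t - p|.
    rewrite -(ler_pXn2r (n := 2))// ?nnegrE// ?mulr_ge0 ?(ltW s0)//.
    by rewrite /s mulrC divfK ?pnatr_eq0// sqr_sqrtr ?(ltW r0).
  (* By the triangle inequality one of [x t - y t] and [y t - p] has norm at
     least half of that of [x t - p]. *)
  have [xy_ge|xy_lt] := leP s `|x t - y t|.
    apply/orP; left; rewrite ler_wpDr ?work_ge0// ler_wpM2l ?(ltW kappa0)//.
    by rewrite ler_pXn2r// ?nnegrE// ltW.
  have yp_ge : s <= `|y t - p|.
    have := ler_normD (x t - y t) (y t - p).
    by rewrite addrA subrK; lra.
  apply/orP; right; rewrite ler_wpDl// ler_wpM2l ?(ltW lambda_gt0)//.
  have yp : y t != p.
    by rewrite -subr_eq0 -normr_gt0; exact: lt_le_trans yp_ge.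
  have dot_ge0 := p_dualP _ (C5_mem t (ltW t0)).
  have := c_le t Mt yp; rewrite (ger0_norm dot_ge0); apply: le_trans.
  rewrite ler_wpM2l ?(ltW c0)// ge0_ler_powR ?nnegrE ?(ltW s0)//.
  by rewrite addr_ge0.
apply/cvgrPdist_lt => e e0.
have /cvgrPdist_lt/(_ _ (exprn_gt0 2 e0)) := sqr_dist_cvg0.
apply: filterS => t; rewrite sub0r normrN ger0_norm ?sqr_ge0// distrC.
by rewrite ltr_pXn2r ?nnegrE// ltW.
Qed.
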